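(* Let $\delta,\gamma>0$ and let $y$ be the solution of the Duffing equation $\ddot y+y+y^3=0$ with $y(0)=\delta$, $\dot y(0)=0$. Define $$\Phi(\delta,\gamma):=2\sqrt{2}\int_0^{\pi/2}\sqrt{\frac{\gamma+\delta^2\sin^2\theta}{2+\delta^2+\delta^2\sin^2\theta}}\;d\theta .$$ If there exists $\ell\in\mathbb{N}$ such that $$\log\Big(1+\frac{\delta^2}{\gamma}\Big)<2\cdot\min\big\{\Phi(\delta,\gamma)-\ell\pi,\ (\ell+1)\pi-\Phi(\delta,\gamma)\big\},$$ then the trivial solution of $$\ddot{\xi}(t)+\big(\gamma+y(t)^2\big)\xi(t)=0$$ is stable.
   Context: $\mathbb{N}$ includes $0$. The trivial solution $\xi\equiv0$ of the linear equation $\ddot\xi+p(t)\xi=0$ is called stable if all solutions are bounded on $\mathbb{R}$. *)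

(* Defs.v *)
(* Stdlib real numbers with Coquelicot. *)
From Stdlib Require Import Reals.
From Coquelicot Require Import Coquelicot.

Open Scope R_scope.

(* [Derive] is total, with a default value where the derivative does not exist,
   so [ex_derive_n f 2 t] alone would not give differentiability of [f]. *)
Definition twice_differentiable (f : R -> R) : Prop :=
  forall t : R, ex_derive f t /\ ex_derive_n f 2 t.

Definition duffing_solution (y : R -> R) : Prop :=
  twice_differentiable y /\
  forall t : R, Derive_n y 2 t + y t + y t ^ 3 = 0.

Definition linear_solution (p xi : R -> R) : Prop :=
  twice_differentiable xi /\
  forall t : R, Derive_n xi 2 t + p t * xi t = 0.

Definition bounded_on_R (f : R -> R) : Prop :=
  exists M : R, forall t : R, Rabs (f t) <= M.

Definition trivial_solution_stable (p : R -> R) : Prop :=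
  forall xi : R -> R, linear_solution p xi -> bounded_on_R xi.

Definition Phi (delta gamma : R) : R :=
  2 * sqrt 2 *
  RInt (fun theta : R =>
          sqrt ((gamma + delta ^ 2 * sin theta ^ 2) /
                (2 + delta ^ 2 + delta ^ 2 * sin theta ^ 2)))
       0 (PI / 2).

(* Main.v *)
(* The solution is [y = delta cos theta] with
   [theta' = sqrt ((2 + delta^2 + y^2) / 2)], so [p = gamma + y^2] has period
   [P = theta^-1 (pi)] and the integral of [sqrt p] over a period is
   [Phi delta gamma].  The Pruefer angle of a solution of the linear equation
   grows over one period by [Phi] up to an error of half
   [ln (max p / min p) = ln (1 + delta^2 / gamma)], hence by an amount strictly
   between [l pi] and [(l + 1) pi].  The monodromy over one period thus has no
   real eigenvector, which means that it is elliptic. *)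

Require Import Defs.
From Stdlib Require Import Reals ZArith Lra Lia.
From Coquelicot Require Import Coquelicot.

Open Scope R_scope.

(** * The linear equation as a first-order system *)

Definition solves (p x v : R -> R) : Prop :=
  forall t : R, is_derive x t (v t) /\ is_derive v t (- p t * x t).

Ltac rewrite_derive :=
  repeat match goal with
    | H : is_derive _ _ _ |- context [Derive ?f ?t] =>
        rewrite (is_derive_unique f t _ H)
    end.

Ltac auto_derive_with :=
  auto_derive;
  [ repeat split; first [exact I | eexists; eassumption]
  | rewrite_derive; unfold Rminus; ring ].

Lemma linear_solution_solves (p xi : R -> R) :
  linear_solution p xi -> solves p xi (Derive xi).
Proof.
intros [Hd He] t; destruct (Hd t) as [H1 H2]; split.
- now apply Derive_correct.
- replace (- p t * xi t) with (Derive (Derive xi) t).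
  + apply Derive_correct, H2.
  + specialize (He t); change (Derive_n xi 2 t) with (Derive (Derive xi) t) in He; lra.
Qed.

(** * Monotonicity, translation and primitives *)

Lemma incr_of_derive_ge0 (f df : R -> R) (a b : R) :
  (forall x, is_derive f x (df x)) -> a <= b ->
  (forall x, a <= x <= b -> 0 <= df x) -> f a <= f b.
Proof.
intros Hf Hab Hpos.
destruct (MVT_gen f a b df) as [c [Hc E]].
- intros x _; apply Hf.
- intros x _; apply derivable_continuous_pt; exists (df x); apply is_derive_Reals, Hf.
- rewrite Rmin_left, Rmax_right in Hc by lra.
  specialize (Hpos c Hc); nra.
Qed.

Lemma decr_of_derive_le0 (f df : R -> R) (a b : R) :
  (forall x, is_derive f x (df x)) -> a <= b ->
  (forall x, a <= x <= b -> df x <= 0) -> f b <= f a.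
Proof.
intros Hf Hab Hneg.
enough (- f a <= - f b) by lra.
apply (incr_of_derive_ge0 (fun x => - f x) (fun x => - df x)); auto.
- intros x; now apply (is_derive_opp f).
- intros x Hx; specialize (Hneg x Hx); lra.
Qed.

Lemma const_of_derive_0 (f : R -> R) (a b : R) :
  (forall x, is_derive f x 0) -> f a = f b.
Proof.
intros Hf; destruct (Rle_dec a b) as [H | H]; apply Rle_antisym.
- apply (incr_of_derive_ge0 f (fun _ => 0)); auto; intros; lra.
- apply (decr_of_derive_le0 f (fun _ => 0)); auto; intros; lra.
- apply (decr_of_derive_le0 f (fun _ => 0)); auto; intros; lra.
- apply (incr_of_derive_ge0 f (fun _ => 0)); auto; intros; lra.
Qed.

Lemma is_derive_eq (f : R -> R) (x l l' : R) :
  is_derive f x l -> l = l' -> is_derive f x l'.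
Proof. now intros H <-. Qed.

Lemma is_derive_shift (f : R -> R) (c t l : R) :
  is_derive f (t + c) l -> is_derive (fun s => f (s + c)) t l.
Proof.
intros H; apply is_derive_eq with (1 * l); [| ring].
apply (is_derive_comp f (fun s => s + c)); [exact H |].
auto_derive; auto; ring.
Qed.

Lemma continuous_of_derive (f df : R -> R) :
  (forall t, is_derive f t (df t)) -> forall t, continuous f t.
Proof.
intros H t; apply (ex_derive_continuous (K := R_AbsRing) (V := R_NormedModule)).
now exists (df t).
Qed.

Lemma is_derive_RInt_continuous (f : R -> R) (a t : R) :
  (forall s, continuous f s) -> is_derive (RInt f a) t (f t).
Proof.
intros Hf; apply (is_derive_RInt f (RInt f a) a t); [| apply Hf].
apply filter_forall; intros s; apply (RInt_correct (V := R_CompleteNormedModule)).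
apply (ex_RInt_continuous (V := R_CompleteNormedModule)); auto.
Qed.

(** * Uniqueness, Wronskian and the solution space *)

(** Gronwall for [E = x^2 + v^2]: since [|2 x v| <= E], its derivative [2 x v (1 - p)] is at most
    [(1 + C) E] in absolute value, so an exponential factor makes [E] monotone on each side of
    [t0]. *)
Lemma solves_unique0 (p x v : R -> R) (C t0 : R) :
  (forall t, Rabs (p t) <= C) -> solves p x v -> x t0 = 0 -> v t0 = 0 ->
  forall t, x t = 0 /\ v t = 0.
Proof.
intros Hp Hs Hx0 Hv0 t.
pose (E := fun s => x s ^ 2 + v s ^ 2).
pose (dE := fun s => 2 * x s * v s * (1 - p s)).
assert (HE : forall s : R, is_derive E s (dE s)).
{ intros s; destruct (Hs s) as [H1 H2]; unfold E, dE.
  auto_derive_with. }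
assert (HdE : forall s, Rabs (dE s) <= (1 + C) * E s).
{ intros s; unfold dE, E.
  specialize (Hp s); apply Rabs_le_between in Hp.
  apply Rabs_le_between.
  pose proof (Rle_0_sqr (x s + v s)) as S1; pose proof (Rle_0_sqr (x s - v s)) as S2.
  unfold Rsqr in S1, S2; split; nra. }
assert (HE0 : E t0 = 0) by (unfold E; rewrite Hx0, Hv0; ring).
assert (Hexp : forall k s : R, is_derive (fun s => E s * exp (k * (s - t0))) s
                 ((dE s + k * E s) * exp (k * (s - t0)))).
{ intros k s; pose proof (HE s).
  clearbody E dE; auto_derive_with. }
assert (HEt : E t <= 0).
{ assert (Hfin : forall k, E t * exp (k * (t - t0)) <= E t0 * exp (k * (t0 - t0)) ->
            E t <= 0).
  { intros k H; rewrite HE0 in H; pose proof (exp_pos (k * (t - t0))); nra. }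
  destruct (Rle_dec t0 t) as [H | H].
  - apply (Hfin (- (1 + C))).
    apply (decr_of_derive_le0 _ _ t0 t (Hexp (- (1 + C)))); auto.
    intros s _; specialize (HdE s); apply Rabs_le_between in HdE.
    pose proof (exp_pos (- (1 + C) * (s - t0))); nra.
  - apply (Hfin (1 + C)).
    apply (incr_of_derive_ge0 _ _ t t0 (Hexp (1 + C))); [lra |].
    intros s _; specialize (HdE s); apply Rabs_le_between in HdE.
    pose proof (exp_pos ((1 + C) * (s - t0))); nra. }
unfold E in HEt; split; nra.
Qed.

Lemma wronskian_const (p x v x' v' : R -> R) (s t : R) :
  solves p x v -> solves p x' v' ->
  x s * v' s - v s * x' s = x t * v' t - v t * x' t.
Proof.
intros H H'.
apply (const_of_derive_0 (fun r => x r * v' r - v r * x' r)).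
intros r; destruct (H r) as [H1 H2], (H' r) as [H3 H4].
auto_derive_with.
Qed.

Lemma solves_comb (p x v x' v' : R -> R) (a b : R) :
  solves p x v -> solves p x' v' ->
  solves p (fun t => a * x t + b * x' t) (fun t => a * v t + b * v' t).
Proof.
intros H H' r; destruct (H r) as [H1 H2], (H' r) as [H3 H4]; split; auto_derive_with.
Qed.

Lemma solves_shift (p x v : R -> R) (P : R) :
  (forall t, p (t + P) = p t) -> solves p x v ->
  solves p (fun t => x (t + P)) (fun t => v (t + P)).
Proof.
intros HP H t; destruct (H (t + P)) as [H1 H2]; split; apply is_derive_shift; auto.
now rewrite HP in H2.
Qed.

(** * Floquet theory: stability from the absence of real multipliers *)

Lemma periodic_continuous_bounded (f : R -> R) (P : R) :
  0 < P -> (forall t, f (t + P) = f t) -> (forall t, continuous f t) ->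
  exists M, forall t, f t <= M.
Proof.
intros HP Hper Hc.
destruct (continuity_ab_maj f 0 P) as [m [Hm _]]; [lra | |].
{ intros t _; apply continuity_pt_filterlim, Hc. }
exists (f m); intros t.
assert (Hn : forall (n : nat) s, f (s + INR n * P) = f s).
{ induction n as [| n IH]; intros s.
  - f_equal; simpl; ring.
  - rewrite S_INR; replace (s + (INR n + 1) * P) with (s + INR n * P + P) by ring.
    now rewrite Hper. }
assert (Hz : forall (n : Z) s, f (s + IZR n * P) = f s).
{ intros n s; destruct (Z.le_ge_cases 0 n) as [H | H].
  - rewrite <- (Z2Nat.id n), <- INR_IZR_INZ; auto.
  - rewrite <- (Hn (Z.to_nat (- n))); f_equal.
    rewrite INR_IZR_INZ, Z2Nat.id, opp_IZR by lia; ring. }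
(* [up r - 1] is the floor of [r], so this translate of [t] lies in [[0, P)]. *)
destruct (archimed (t / P)) as [H1 H2].
rewrite <- (Hz (1 - up (t / P))%Z t).
apply Hm; rewrite minus_IZR.
assert (t = t / P * P) by (field; lra).
split; nra.
Qed.

(* A solution [xi] not proportional to [xi (. + P)] spans the solution space
   together with it, so [xi (t + 2 P) = a * xi (t + P) - xi t] and no
   fundamental system has to be constructed.  A real root [k] of
   [k^2 - a k + 1] would make [xi (. + P) - k * xi] a Floquet solution; hence
   [|a| < 2], and the invariant quadratic form is definite. *)
Lemma stable_of_no_real_multiplier (p : R -> R) (P C : R) :
  0 < P -> (forall t, p (t + P) = p t) -> (forall t, Rabs (p t) <= C) ->
  (forall x v, solves p x v -> x P * v 0 - v P * x 0 = 0 -> x 0 = 0 /\ v 0 = 0) ->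
  trivial_solution_stable p.
Proof.
intros HP Hper HC Hrot xi Hxi.
apply linear_solution_solves in Hxi; revert Hxi.
generalize (Derive xi) as v; intros v Hs.
pose proof (solves_shift p xi v P Hper Hs) as Hs1.
pose proof (solves_shift p _ _ P Hper Hs1) as Hs2; cbv beta in Hs2.
pose (W := xi 0 * v P - v 0 * xi P).
(* If the Wronskian [W] of [xi] and its translate vanishes, [Hrot] applies to [xi] itself, which is
   then zero. *)
destruct (Req_dec W 0) as [HW | HW].
{ destruct (Hrot xi v Hs) as [Hx0 Hv0]; [unfold W in HW; lra |].
  exists 0; intros t.
  destruct (solves_unique0 p xi v C 0 HC Hs Hx0 Hv0 t) as [-> _].
  rewrite Rabs_R0; lra. }
pose (x2 := xi (0 + P + P)); pose (v2 := v (0 + P + P)).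
(* Cramer's rule for the second translate in the basis formed by the first translate and [xi]. The
   other coefficient is [-1] because [W] is invariant under the shift ([Hb]). *)
pose (a := (xi 0 * v2 - v 0 * x2) / W).
assert (Hb : xi P * v2 - v P * x2 = W).
{ pose proof (wronskian_const p _ _ _ _ P 0 Hs Hs1) as H; cbv beta in H.
  rewrite Rplus_0_l in H; unfold x2, v2; rewrite Rplus_0_l; exact H. }
assert (Hrec : forall t, xi (t + P + P) = a * xi (t + P) - xi t /\
                         v (t + P + P) = a * v (t + P) - v t).
{ intros t.
  destruct (solves_unique0 p _ _ C 0 HC
      (solves_comb p _ _ _ _ 1 (-1) Hs2 (solves_comb p _ _ _ _ a (-1) Hs1 Hs)))
    with (t := t) as [H1 H2].
  - fold x2; rewrite Rplus_0_l.
    apply Rmult_eq_reg_r with W; [| exact HW].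
    unfold a; field_simplify; [| exact HW].
    rewrite <- Hb at 2; unfold W; ring.
  - fold v2; rewrite Rplus_0_l.
    apply Rmult_eq_reg_r with W; [| exact HW].
    unfold a; field_simplify; [| exact HW].
    rewrite <- Hb at 2; unfold W; ring.
  - split; lra. }
assert (Ha : Rabs a < 2).
{ apply Rnot_le_lt; intros Ha.
  assert (Hk : exists k, k * k - a * k + 1 = 0).
  { exists ((a + sqrt (a * a - 4)) / 2).
    assert (4 <= a * a).
    { pose proof (Rsqr_abs a) as Hq; unfold Rsqr in Hq; nra. }
    pose proof (sqrt_sqrt (a * a - 4)) as Hq; specialize (Hq ltac:(lra)); nra. }
  destruct Hk as [k Hk].
  destruct (Hrot _ _ (solves_comb p _ _ _ _ 1 (- k) Hs1 Hs)) as [Z1 Z2].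
  - destruct (Hrec 0) as [R1 R2]; rewrite Rplus_0_l in *.
    rewrite R1, R2.
    (* The Floquet condition is the characteristic polynomial at [k] times the Wronskian. *)
    transitivity ((k * k - a * k + 1) * (v 0 * xi P - xi 0 * v P)); [ring |].
    rewrite Hk; ring.
  - rewrite Rplus_0_l in *; apply HW; unfold W.
    replace (v P) with (k * v 0) by lra; replace (xi P) with (k * xi 0) by lra; ring. }
pose (Q := fun t => xi (t + P) ^ 2 - a * xi (t + P) * xi t + xi t ^ 2).
destruct (periodic_continuous_bounded Q P HP) as [M HM].
- intros t; unfold Q; destruct (Hrec t) as [-> _]; ring.
- intros t; apply (ex_derive_continuous (K := R_AbsRing) (V := R_NormedModule)).
  unfold Q; auto_derive; repeat split; eexists; apply Hs.
- apply Rabs_lt_between in Ha.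
  (* Completing the square: [Q t = (xi (t + P) - a / 2 * xi t)^2 + c * xi t ^ 2]. *)
  pose (c := 1 - a ^ 2 / 4).
  assert (Hc : 0 < c) by (unfold c; pose proof (Rmult_lt_0_compat (2 - a) (2 + a)
                                 ltac:(lra) ltac:(lra)); lra).
  (* The summand 1 passes from the square to [xi], by [|s| <= s^2 + 1]. *)
  exists (M / c + 1); intros t.
  assert (Hq : c * xi t ^ 2 <= M).
  { specialize (HM t); unfold Q in HM; unfold c.
    pose proof (pow2_ge_0 (xi (t + P) - a / 2 * xi t)); nra. }
  assert (xi t ^ 2 <= M / c) by (clearbody c; apply -> Rle_div_r; lra).
  apply Rabs_le_between; split; nra.
Qed.

(** * Rotation of the Pruefer angle *)

(** For [z = a + i b] the system reads [z' = (k + i w) z], so [z P] is a positive multiple of [z 0]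
    rotated by [phi P]; it is parallel to [z 0] only for a multiple of [PI]. *)
Lemma sin_angle_0_of_parallel (a b k w phi : R -> R) (P : R) :
  (forall t, is_derive a t (k t * a t - w t * b t)) ->
  (forall t, is_derive b t (k t * b t + w t * a t)) ->
  (forall t, is_derive phi t (w t)) -> phi 0 = 0 ->
  (forall t, 0 < a t ^ 2 + b t ^ 2) ->
  a P * b 0 - b P * a 0 = 0 -> sin (phi P) = 0.
Proof.
intros Ha Hb Hphi Hphi0 Hpos Hpar.
(* The cross product of [z], rotated back by [phi], with [z 0]. *)
pose (B := fun t => b 0 * (a t * cos (phi t) + b t * sin (phi t)) -
                    a 0 * (b t * cos (phi t) - a t * sin (phi t))).
assert (HB : forall t, is_derive B t (k t * B t)).
{ intros t; pose proof (Ha t) as H1; pose proof (Hb t) as H2; pose proof (Hphi t) as H3.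
  unfold B; auto_derive_with. }
assert (HB0 : B 0 = 0) by (unfold B; rewrite Hphi0, sin_0, cos_0; ring).
(* Both [B^2] and [|z|^2] have logarithmic rate [2 k], so their ratio is constant and [k] need not
   be integrated. *)
assert (HBP : B P ^ 2 / (a P ^ 2 + b P ^ 2) = B 0 ^ 2 / (a 0 ^ 2 + b 0 ^ 2)).
{ apply (const_of_derive_0 (fun t => B t ^ 2 / (a t ^ 2 + b t ^ 2))); intros t.
  pose proof (Ha t) as H1; pose proof (Hb t) as H2; pose proof (HB t) as H3.
  specialize (Hpos t); clearbody B; auto_derive.
  - repeat split; first [eexists; eassumption | lra].
  - rewrite_derive.
    field; lra. }
rewrite HB0 in HBP.
assert (HBP0 : B P ^ 2 = 0).
{ pose proof (Hpos P); pose proof (Hpos 0).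
  replace (B P ^ 2) with (B P ^ 2 / (a P ^ 2 + b P ^ 2) * (a P ^ 2 + b P ^ 2))
    by (field; lra).
  rewrite HBP; field; lra. }
assert (HBP1 : B P = 0) by nra.
assert (Hdot : sin (phi P) * (a 0 * a P + b 0 * b P) = 0).
{ transitivity (B P); [unfold B | exact HBP1].
  transitivity (sin (phi P) * (a 0 * a P + b 0 * b P) +
                cos (phi P) * (a P * b 0 - b P * a 0)); [rewrite Hpar |]; ring. }
apply Rmult_integral in Hdot; destruct Hdot as [H | H]; [exact H |].
(* Lagrange's identity: the dot and cross products of nonzero vectors cannot both vanish. *)
pose proof (Rmult_lt_0_compat _ _ (Hpos 0) (Hpos P)) as Hlt.
replace ((a 0 ^ 2 + b 0 ^ 2) * (a P ^ 2 + b P ^ 2)) with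
  ((a 0 * a P + b 0 * b P) ^ 2 + (a P * b 0 - b P * a 0) ^ 2) in Hlt by ring.
rewrite H, Hpar in Hlt; lra.
Qed.

(* Writing [sqrt p * x = r cos phi] and [x' = - r sin phi] gives
   [phi' = sqrt p + p' / (2 p) * s] with [|s| <= 1/2], so on an interval where
   [p] is monotone, [phi] deviates from the integral of [sqrt p] by at most a
   quarter of the variation of [ln p]. *)
Lemma prufer_rotation (p dp K x v : R -> R) (tau P : R) :
  (forall t, 0 < p t) -> (forall t, is_derive p t (dp t)) ->
  (forall t, continuous dp t) -> 0 <= tau <= P ->
  (forall t, 0 <= t <= tau -> dp t <= 0) ->
  (forall t, tau <= t <= P -> 0 <= dp t) ->
  p P = p 0 -> (forall t, is_derive K t (sqrt (p t))) ->
  solves p x v -> (forall t, 0 < x t ^ 2 + v t ^ 2) ->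
  x P * v 0 - v P * x 0 = 0 ->
  exists phi, sin phi = 0 /\
    Rabs (phi - (K P - K 0)) <= (ln (p 0) - ln (p tau)) / 2.
Proof.
intros Hp Hdp Hcdp Htau Hdec Hinc HpP HK Hs Hnz Hpar.
pose (q := fun t => sqrt (p t)).
pose (m := fun t => dp t / (2 * p t)).
pose (a := fun t => q t * x t).
pose (b := fun t => - v t).
assert (Hq : forall t, 0 < q t) by (intros t; apply sqrt_lt_R0, Hp).
assert (Hqq : forall t, q t * q t = p t)
  by (intros t; apply sqrt_sqrt, Rlt_le, Hp).
assert (Hdq : forall t, is_derive q t (m t * q t)).
{ intros t; pose proof (Hdp t) as H; pose proof (Hp t); unfold q; auto_derive.
  - split; [eexists; eassumption | auto].
  - rewrite_derive; unfold m.
    change (sqrt (p t)) with (q t); rewrite <- Hqq; specialize (Hq t); field; lra. }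
assert (Hr : forall t, 0 < a t ^ 2 + b t ^ 2).
{ intros t; unfold a, b; pose proof (Hnz t); pose proof (Hq t).
  destruct (Req_dec (x t) 0) as [E | E].
  - rewrite E in *; nra.
  - pose proof (pow2_ge_0 (- v t)).
    pose proof (Rsqr_pos_lt (q t * x t) ltac:(apply Rmult_integral_contrapositive; lra)).
    unfold Rsqr in *; lra. }
(* The system for [(a, b)] is split into an angular rate [w] and a radial rate [k]; [s] is minus the
   product of the cosine and sine of the angle of [(a, b)]. *)
pose (s := fun t => - (a t * b t) / (a t ^ 2 + b t ^ 2)).
pose (w := fun t => q t + m t * s t).
pose (k := fun t => m t * a t ^ 2 / (a t ^ 2 + b t ^ 2)).
assert (Hda : forall t, is_derive a t (m t * a t - q t * b t)).
{ intros t; destruct (Hs t) as [H1 H2]; pose proof (Hdq t); unfold a, b.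
  clearbody q m; auto_derive_with. }
assert (Hdb : forall t, is_derive b t (q t * a t)).
{ intros t; destruct (Hs t) as [H1 H2]; unfold a, b; auto_derive.
  - eexists; eassumption.
  - rewrite_derive; rewrite <- Hqq; ring. }
assert (Hda' : forall t, is_derive a t (k t * a t - w t * b t)).
{ intros t; apply is_derive_eq with (1 := Hda t).
  unfold k, w, s; specialize (Hr t); field; lra. }
assert (Hdb' : forall t, is_derive b t (k t * b t + w t * a t)).
{ intros t; apply is_derive_eq with (1 := Hdb t).
  unfold k, w, s; specialize (Hr t); field; lra. }
assert (Hcm : forall t, continuous m t).
{ intros t; apply (continuous_mult dp (fun t => / (2 * p t))); [apply Hcdp |].
  apply (ex_derive_continuous (K := R_AbsRing) (V := R_NormedModule)).
  pose proof (Hp t); auto_derive; split; [eexists; apply Hdp | split; [lra | auto]]. }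
assert (Hcw : forall t, continuous w t).
{ intros t; apply (continuous_plus q (fun t => m t * s t)).
  - now apply continuous_of_derive with (df := fun t => m t * q t).
  - apply (continuous_mult m s); [apply Hcm |].
    apply (ex_derive_continuous (K := R_AbsRing) (V := R_NormedModule)).
    pose proof (Hr t); unfold s; clearbody a b; auto_derive.
    repeat split; first [eexists; solve [apply Hda | apply Hdb] | lra]. }
(* Only the increment of the angle since time 0 matters, so no branch of the argument is chosen. *)
pose (phi := RInt w 0).
assert (Hphi : forall t, is_derive phi t (w t))
  by (intros t; now apply is_derive_RInt_continuous).
assert (Hphi0 : phi 0 = 0) by (apply (RInt_point (V := R_CompleteNormedModule))).
exists (phi P); split.
{ apply (sin_angle_0_of_parallel a b k w phi P); auto.
  (* Equal values of [p] at both ends carry parallelism from [(x, v)] to [(a, b)]. *)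
  unfold a, b, q; rewrite HpP.
  transitivity (- sqrt (p 0) * (x P * v 0 - v P * x 0)); [ring | rewrite Hpar; ring]. }
assert (Hsb : forall t, - (1 / 2) <= s t <= 1 / 2).
{ intros t; unfold s; pose proof (Hr t).
  pose proof (pow2_ge_0 (a t - b t)); pose proof (pow2_ge_0 (a t + b t)).
  split; [apply -> Rle_div_r | apply <- Rle_div_l]; nra. }
(* For [c = 1/4] or [c = -1/4] the factor [s t + 2 * c] has a fixed sign, so the sign of [m] decides
   monotonicity. *)
assert (HG : forall c t, is_derive (fun t => phi t - K t + c * ln (p t)) t
                (m t * (s t + 2 * c))).
{ intros c t; pose proof (Hphi t) as H1; pose proof (HK t) as H2; pose proof (Hdp t) as H3.
  pose proof (Hp t); clearbody phi; auto_derive.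
  - repeat split; first [eexists; eassumption | lra].
  - rewrite_derive.
    unfold w, m, q; field; lra. }
assert (Hm1 : forall t, 0 <= t <= tau -> m t <= 0).
{ intros t Ht; specialize (Hdec t Ht); specialize (Hp t).
  apply <- Rle_div_l; lra. }
assert (Hm2 : forall t, tau <= t <= P -> 0 <= m t).
{ intros t Ht; specialize (Hinc t Ht); specialize (Hp t).
  apply -> Rle_div_r; lra. }
(* Two-sided bounds on the two monotone pieces of [p]; each piece costs a quarter of
   [ln (p 0) - ln (p tau)]. *)
assert (B1 := decr_of_derive_le0 _ _ 0 tau (HG (1 / 4)) (proj1 Htau)).
assert (B2 := incr_of_derive_ge0 _ _ 0 tau (HG (- (1 / 4))) (proj1 Htau)).
assert (B3 := incr_of_derive_ge0 _ _ tau P (HG (1 / 4)) (proj2 Htau)).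
assert (B4 := decr_of_derive_le0 _ _ tau P (HG (- (1 / 4))) (proj2 Htau)).
cbv beta in B1, B2, B3, B4; rewrite HpP in B3, B4.
lapply B1; [clear B1; intros B1 | intros t Ht; specialize (Hm1 t Ht); specialize (Hsb t); nra].
lapply B2; [clear B2; intros B2 | intros t Ht; specialize (Hm1 t Ht); specialize (Hsb t); nra].
lapply B3; [clear B3; intros B3 | intros t Ht; specialize (Hm2 t Ht); specialize (Hsb t); nra].
lapply B4; [clear B4; intros B4 | intros t Ht; specialize (Hm2 t Ht); specialize (Hsb t); nra].
apply Rabs_le_between; split; lra.
Qed.

(** * The Duffing oscillator in angular form *)

(** The Duffing equation is read as a linear equation with coefficient [1 + y^2]; the conserved
    quantity is twice the mechanical energy. *)
Lemma duffing_energy (y v : R -> R) (t : R) :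
  solves (fun t => 1 + y t ^ 2) y v ->
  v t ^ 2 + y t ^ 2 + y t ^ 4 / 2 = v 0 ^ 2 + y 0 ^ 2 + y 0 ^ 4 / 2.
Proof.
intros H; apply (const_of_derive_0 (fun t => v t ^ 2 + y t ^ 2 + y t ^ 4 / 2)).
intros s; destruct (H s) as [H1 H2].
auto_derive.
- repeat split; first [exact I | eexists; eassumption].
- rewrite_derive; field.
Qed.

Definition duffing_speed (delta y : R) : R := sqrt ((2 + delta ^ 2 + y ^ 2) / 2).

Lemma duffing_speed_sqr (delta y : R) :
  duffing_speed delta y * duffing_speed delta y = (2 + delta ^ 2 + y ^ 2) / 2.
Proof. apply sqrt_sqrt; nra. Qed.

Lemma duffing_speed_ge1 (delta y : R) : 1 <= duffing_speed delta y.
Proof. rewrite <- sqrt_1; apply sqrt_le_1_alt; nra. Qed.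

(* The angle is normalized so that [y = delta cos theta]; energy conservation
   [y'^2 = (delta^2 - y^2) (2 + delta^2 + y^2) / 2] then forces
   [theta' = duffing_speed delta y]. *)
Lemma duffing_angle (delta : R) (y v : R -> R) :
  0 < delta -> solves (fun t => 1 + y t ^ 2) y v -> y 0 = delta -> v 0 = 0 ->
  exists theta : R -> R, theta 0 = 0 /\ forall t,
    is_derive theta t (duffing_speed delta (y t)) /\
    y t = delta * cos (theta t) /\
    v t = - delta * sin (theta t) * duffing_speed delta (y t).
Proof.
intros Hd Hs Hy0 Hv0.
pose (w := fun t => duffing_speed delta (y t)).
assert (Hw : forall t, 1 <= w t) by (intros t; apply duffing_speed_ge1).
assert (Hww : forall t, w t * w t = (2 + delta ^ 2 + y t ^ 2) / 2)
  by (intros t; apply duffing_speed_sqr).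
assert (Hv : forall t, v t ^ 2 = (delta ^ 2 - y t ^ 2) * (w t * w t)).
{ intros t; pose proof (duffing_energy y v t Hs) as E.
  rewrite Hy0, Hv0 in E; rewrite Hww; nra. }
assert (Hdw : forall t, is_derive w t (y t * v t / (2 * w t))).
{ intros t; destruct (Hs t) as [H _]; pose proof (Hw t) as Hwt.
  unfold w, duffing_speed; auto_derive.
  - split; [eexists; eassumption | split; [nra | exact I]].
  - rewrite_derive.
    replace (sqrt _) with (w t) by (unfold w, duffing_speed; f_equal; field).
    change (sqrt ((2 + delta ^ 2 + y t ^ 2) / 2)) with (w t); field; lra. }
pose (theta := RInt w 0).
assert (Hth : forall t, is_derive theta t (w t)).
{ intros t; apply is_derive_RInt_continuous.
  now apply continuous_of_derive with (1 := Hdw). }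
assert (Hth0 : theta 0 = 0) by (apply (RInt_point (V := R_CompleteNormedModule))).
clearbody theta.
(* Candidates for the cosine and sine of [theta]. Using [v] itself avoids choosing a sign for the
   root of the energy identity. *)
pose (a := fun t => y t / delta); pose (b := fun t => - v t / (delta * w t)).
assert (Ha : forall t, is_derive a t (- w t * b t)).
{ intros t; destruct (Hs t) as [H _]; pose proof (Hw t); unfold a, b; auto_derive.
  - eexists; eassumption.
  - rewrite_derive; field; lra. }
assert (Hb : forall t, is_derive b t (w t * a t)).
{ intros t; destruct (Hs t) as [H1 H2]; pose proof (Hw t); pose proof (Hdw t).
  specialize (Hww t); specialize (Hv t).
  assert (Hnz : delta * w t <> 0) by (apply Rmult_integral_contrapositive; lra).
  unfold a, b; clearbody w; auto_derive.
  - repeat split; first [eexists; eassumption | exact Hnz].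
  - rewrite_derive.
    (* After [Hv] the numerator contains [1 + y^2 + (delta^2 - y^2) / 2], which is [w^2]. *)
    transitivity (((1 + y t ^ 2) * y t * (w t * w t) + y t * v t ^ 2 / 2) /
                  (delta * (w t * w t * w t))); [field; lra |].
    rewrite Hv.
    transitivity (y t * ((2 + delta ^ 2 + y t ^ 2) / 2) / (delta * w t)); [field; lra |].
    rewrite <- Hww; field; lra. }
(* Rotating [(a, b)] back by [theta] gives a constant vector, namely [(1, 0)]. *)
assert (HA : forall t, a t * cos (theta t) + b t * sin (theta t) = 1).
{ intros t; transitivity (a 0 * cos (theta 0) + b 0 * sin (theta 0)).
  - apply (const_of_derive_0 (fun t => a t * cos (theta t) + b t * sin (theta t))).
    intros s; pose proof (Ha s); pose proof (Hb s); pose proof (Hth s).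
    clearbody a b w; auto_derive_with.
  - rewrite Hth0, sin_0, cos_0; unfold a, b; rewrite Hy0; field.
    pose proof (Hw 0); lra. }
assert (HB : forall t, b t * cos (theta t) - a t * sin (theta t) = 0).
{ intros t; transitivity (b 0 * cos (theta 0) - a 0 * sin (theta 0)).
  - apply (const_of_derive_0 (fun t => b t * cos (theta t) - a t * sin (theta t))).
    intros s; pose proof (Ha s); pose proof (Hb s); pose proof (Hth s).
    clearbody a b w; auto_derive_with.
  - rewrite Hth0, sin_0, cos_0; unfold a, b; rewrite Hv0; field.
    pose proof (Hw 0); lra. }
exists theta; split; [exact Hth0 |]; intros t.
pose proof (sin2_cos2 (theta t)) as SC; unfold Rsqr in SC.
assert (Ea : a t = cos (theta t)).
{ transitivity (a t * (sin (theta t) * sin (theta t) + cos (theta t) * cos (theta t)));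
    [rewrite SC; ring |].
  transitivity ((a t * cos (theta t) + b t * sin (theta t)) * cos (theta t) -
                (b t * cos (theta t) - a t * sin (theta t)) * sin (theta t)); [ring |].
  rewrite HA, HB; ring. }
assert (Eb : b t = sin (theta t)).
{ transitivity (b t * (sin (theta t) * sin (theta t) + cos (theta t) * cos (theta t)));
    [rewrite SC; ring |].
  transitivity ((a t * cos (theta t) + b t * sin (theta t)) * sin (theta t) +
                (b t * cos (theta t) - a t * sin (theta t)) * cos (theta t)); [ring |].
  rewrite HA, HB; ring. }
split; [apply Hth | split].
- rewrite <- Ea; unfold a; field; lra.
- rewrite <- Eb; unfold b; change (duffing_speed delta (y t)) with (w t).
  field; pose proof (Hw t); lra.
Qed.

(** By [r^3 + s^3 = (r + s) (r^2 - r s + s^2)], the sum of [y] and its translate solves a linear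
    equation with bounded coefficient [g] and zero initial data. *)
Lemma duffing_antiperiodic (y v : R -> R) (C P : R) :
  solves (fun t => 1 + y t ^ 2) y v -> (forall t, y t ^ 2 <= C) ->
  y P = - y 0 -> v P = - v 0 -> forall t, y (t + P) = - y t.
Proof.
intros Hs HC HyP HvP t.
pose (g := fun t => 1 + y (t + P) ^ 2 - y (t + P) * y t + y t ^ 2).
destruct (solves_unique0 g (fun t => y (t + P) + y t) (fun t => v (t + P) + v t)
            (1 + 3 * C) 0) with (t := t) as [H _].
- intros s; unfold g; pose proof (HC s); pose proof (HC (s + P)).
  pose proof (pow2_ge_0 (y (s + P) - y s)); pose proof (pow2_ge_0 (y (s + P) + y s)).
  apply Rabs_le_between; split; nra.
- intros s; destruct (Hs s) as [H1 H2], (Hs (s + P)) as [H3 H4].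
  apply is_derive_shift in H3; apply is_derive_shift in H4; cbv beta in H4.
  split.
  + now apply (is_derive_plus (fun s => y (s + P)) y).
  + apply is_derive_eq with
      (- (1 + y (s + P) ^ 2) * y (s + P) + - (1 + y s ^ 2) * y s).
    * now apply (is_derive_plus (fun s => v (s + P)) v).
    * unfold g; ring.
- cbv beta; rewrite Rplus_0_l; lra.
- cbv beta; rewrite Rplus_0_l; lra.
- lra.
Qed.

(** * [Phi] as the integral over a period, and the stability criterion *)

(** Folds the range [[-PI/2, PI/2]] of the shifted angle onto the range [[0, PI/2]] used in
    [Phi]. *)
Lemma RInt_even_minus (h : R -> R) (c : R) :
  (forall s, continuous h s) -> (forall s, h (- s) = h s) ->
  RInt h 0 c - RInt h 0 (- c) = 2 * RInt h 0 c.
Proof.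
intros Hc He.
enough (H : RInt h 0 c + RInt h 0 (- c) = 0) by lra.
transitivity (RInt h 0 0 + RInt h 0 (- 0)).
- apply (const_of_derive_0 (fun s => RInt h 0 s + RInt h 0 (- s))); intros s.
  pose proof (is_derive_RInt_continuous h 0 s Hc) as H1.
  pose proof (is_derive_RInt_continuous h 0 (- s) Hc) as H2; rewrite He in H2.
  revert H1 H2; generalize (RInt h 0); intros H H1 H2.
  auto_derive_with.
- rewrite Ropp_0, RInt_point; unfold zero; simpl; ring.
Qed.

Lemma sin_neq_0_between (l : nat) (x : R) :
  INR l * PI < x < (INR l + 1) * PI -> sin x <> 0.
Proof.
intros Hx H; apply sin_eq_0_0 in H; destruct H as [k ->].
pose proof PI_RGT_0.
rewrite INR_IZR_INZ in Hx; destruct Hx as [H1 H2].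
apply Rmult_lt_reg_r, lt_IZR in H1; [| assumption].
apply Rmult_lt_reg_r in H2; [| assumption].
rewrite <- plus_IZR in H2; apply lt_IZR in H2; lia.
Qed.

Theorem theorem6 (delta gamma : R) (y : R -> R)
  (hdelta : 0 < delta) (hgamma : 0 < gamma)
  (hy : duffing_solution y) (hy0 : y 0 = delta) (hdy0 : Derive y 0 = 0)
  (hPhi : exists l : nat,
     ln (1 + delta ^ 2 / gamma) <
     2 * Rmin (Phi delta gamma - INR l * PI)
              ((INR l + 1) * PI - Phi delta gamma)) :
  trivial_solution_stable (fun t : R => gamma + y t ^ 2).
Proof.
assert (Hs : solves (fun t => 1 + y t ^ 2) y (Derive y)).
{ apply linear_solution_solves; destruct hy as [H1 H2]; split; [exact H1 |].
  intros t; rewrite <- (H2 t); ring. }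
revert Hs hdy0; generalize (Derive y) as v; intros v Hs Hv0; clear hy.
destruct (duffing_angle delta y v hdelta Hs hy0 Hv0) as [theta [Hth0 Hth]].
pose (w := fun t => duffing_speed delta (y t)).
assert (Hdth : forall t, is_derive theta t (w t)) by apply Hth.
assert (Hy : forall t, y t = delta * cos (theta t)) by apply Hth.
assert (Hv : forall t, v t = - delta * sin (theta t) * w t) by apply Hth.
assert (Hw : forall t, 1 <= w t) by (intros t; apply duffing_speed_ge1).
clear Hth.
pose proof PI_RGT_0 as HPI.
assert (Hinc : forall s t, s <= t -> theta s <= theta t).
{ intros s t Hst; apply (incr_of_derive_ge0 theta w); auto.
  intros r _; specialize (Hw r); lra. }
assert (Hthc : continuity theta).
{ intros t; apply continuity_pt_filterlim.
  now apply continuous_of_derive with (1 := Hdth). }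
(* The speed is at least 1, so [theta] reaches [PI] by time [PI]. *)
assert (HthPI : PI <= theta PI).
{ enough (theta 0 - 0 <= theta PI - PI) by lra.
  apply (incr_of_derive_ge0 (fun t => theta t - t) (fun t => w t - 1)); [| lra |].
  - intros t; pose proof (Hdth t); auto_derive_with.
  - intros t _; specialize (Hw t); lra. }
destruct (IVT_gen theta 0 PI PI Hthc) as [P [HP HthP]].
{ rewrite Rmin_left, Rmax_right; lra. }
rewrite Rmin_left, Rmax_right in HP by lra.
destruct (IVT_gen theta 0 P (PI / 2) Hthc) as [tau [Htau Hthtau]].
{ rewrite Rmin_left, Rmax_right; lra. }
rewrite Rmin_left, Rmax_right in Htau by lra.
assert (HP0 : 0 < P).
{ destruct (Req_dec P 0) as [E | E]; [rewrite E in HthP |]; lra. }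
assert (Hybound : forall t, y t ^ 2 <= delta ^ 2).
{ intros t; rewrite Hy; rewrite Rpow_mult_distr.
  assert (cos (theta t) ^ 2 <= 1) by (pose proof (COS_bound (theta t)); nra).
  pose proof (pow2_ge_0 delta); nra. }
assert (HyP : forall t, y (t + P) = - y t).
{ apply (duffing_antiperiodic y v (delta ^ 2) P Hs Hybound).
  - rewrite !Hy, HthP, Hth0, cos_PI, cos_0; ring.
  - rewrite Hv0, Hv, HthP, sin_PI; ring. }
pose (p := fun t => gamma + y t ^ 2).
assert (Hp : forall t, 0 < p t) by (intros t; unfold p; nra).
assert (Hpbound : forall t, Rabs (p t) <= gamma + delta ^ 2).
{ intros t; rewrite Rabs_pos_eq by (apply Rlt_le, Hp).
  specialize (Hybound t); unfold p; lra. }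
apply (stable_of_no_real_multiplier p P (gamma + delta ^ 2)); auto.
{ intros t; unfold p; rewrite HyP; ring. }
intros x u Hxu Hpar.
destruct (Rle_dec (x 0 ^ 2 + u 0 ^ 2) 0) as [H0 | H0]; [split; nra | exfalso].
assert (Hnz : forall t, 0 < x t ^ 2 + u t ^ 2).
{ intros t; apply Rnot_le_lt; intros Ht; apply H0.
  destruct (solves_unique0 p x u (gamma + delta ^ 2) t Hpbound Hxu) with (t := 0)
    as [-> ->]; nra. }
pose (h := fun s => sqrt ((gamma + delta ^ 2 * sin s ^ 2) /
                          (2 + delta ^ 2 + delta ^ 2 * sin s ^ 2))).
assert (Hsq : forall s, 0 <= delta ^ 2 * sin s ^ 2).
{ intros s; apply Rmult_le_pos; apply pow2_ge_0. }
assert (Hhc : forall s, continuous h s).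
{ intros s; apply (ex_derive_continuous (K := R_AbsRing) (V := R_NormedModule)).
  pose proof (Hsq s); pose proof (pow2_ge_0 delta); unfold h; auto_derive.
  simpl in *; repeat split; [lra |].
  apply Rdiv_lt_0_compat; lra. }
(* A primitive of [sqrt p] by the substitution [theta]; the shift by [PI / 2] turns the cosine in
   [y] into the sine in [Phi]. *)
pose (K := fun t => sqrt 2 * RInt h 0 (theta t - PI / 2)).
assert (HK : forall t, is_derive K t (sqrt (p t))).
{ intros t; pose proof (is_derive_RInt_continuous h 0 (theta t - PI / 2) Hhc) as H1.
  pose proof (Hdth t) as H2.
  apply is_derive_eq with (sqrt 2 * h (theta t - PI / 2) * w t).
  - unfold K; revert H1; generalize (RInt h 0); intros F H1; auto_derive_with.
  - pose proof (pow2_ge_0 delta); pose proof (pow2_ge_0 (y t)); pose proof (Hp t).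
    unfold h, w, duffing_speed.
    replace (delta ^ 2 * sin (theta t - PI / 2) ^ 2) with (y t ^ 2).
    2: { rewrite Hy, sin_minus, sin_PI2, cos_PI2; ring. }
    change (gamma + y t ^ 2) with (p t).
    rewrite <- !sqrt_mult_alt.
    + f_equal; field; lra.
    + apply Rmult_le_pos; [lra |].
      apply Rlt_le, Rdiv_lt_0_compat; lra.
    + lra. }
assert (HKP : K P - K 0 = Phi delta gamma).
{ unfold K; rewrite HthP, Hth0.
  replace (PI - PI / 2) with (PI / 2) by field.
  replace (0 - PI / 2) with (- (PI / 2)) by field.
  rewrite <- Rmult_minus_distr_l, (RInt_even_minus h _ Hhc).
  - unfold Phi; fold h; ring.
  - intros s; unfold h; rewrite sin_neg; f_equal; f_equal; ring. }
(* The derivative of [p] has the sign of [- sin theta cos theta], which changes at [tau]. *)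
assert (Hyv : forall t, 2 * y t * v t =
                        - (2 * delta ^ 2 * w t) * (sin (theta t) * cos (theta t))).
{ intros t; rewrite Hy, Hv; ring. }
destruct (prufer_rotation p (fun t => 2 * y t * v t) K x u tau P)
  as [phi [Hphi Hdist]]; auto.
- intros t; destruct (Hs t) as [H1 _]; unfold p; auto_derive_with.
- intros t; apply (ex_derive_continuous (K := R_AbsRing) (V := R_NormedModule)).
  destruct (Hs t) as [H1 H2].
  auto_derive; repeat split; eexists; eassumption.
- intros t Ht.
  assert (Hc : 0 <= theta t <= PI / 2).
  { pose proof (Hinc 0 t); pose proof (Hinc t tau); lra. }
  assert (0 <= sin (theta t)) by (apply sin_ge_0; lra).
  assert (0 <= cos (theta t)) by (apply cos_ge_0; lra).
  assert (0 <= sin (theta t) * cos (theta t)) by nra.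
  rewrite Hyv; specialize (Hw t).
  assert (0 <= 2 * delta ^ 2 * w t) by nra; nra.
- intros t Ht.
  assert (Hc : PI / 2 <= theta t <= PI).
  { pose proof (Hinc tau t); pose proof (Hinc t P); lra. }
  assert (0 <= sin (theta t)) by (apply sin_ge_0; lra).
  assert (cos (theta t) <= 0) by (apply cos_le_0; lra).
  assert (sin (theta t) * cos (theta t) <= 0) by nra.
  rewrite Hyv; specialize (Hw t).
  assert (0 <= 2 * delta ^ 2 * w t) by nra; nra.
- unfold p; replace P with (0 + P) by ring; rewrite HyP; ring.
- rewrite HKP in Hdist.
  destruct hPhi as [l Hl].
  apply (sin_neq_0_between l phi); [| exact Hphi].
  (* [p] falls from [gamma + delta^2] at time 0 to [gamma] at [tau], where [y] vanishes. *)
  assert (E : ln (p 0) - ln (p tau) = ln (1 + delta ^ 2 / gamma)).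
  { replace (p tau) with gamma.
    2: { unfold p; rewrite Hy, Hthtau, cos_PI2; ring. }
    rewrite <- ln_div; auto.
    f_equal; unfold p; rewrite hy0; field; lra. }
  rewrite E in Hdist.
  apply Rabs_le_between in Hdist.
  pose proof (Rmin_l (Phi delta gamma - INR l * PI) ((INR l + 1) * PI - Phi delta gamma)).
  pose proof (Rmin_r (Phi delta gamma - INR l * PI) ((INR l + 1) * PI - Phi delta gamma)).
  lra.
Qed.
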